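(* At every point $(\bm\lambda,\bm\Gamma)$ of $\mathcal S$ the following hold. For $1\le a,b\le p$ and $1\le s<t\le p$, $$\overset{e}{H}_{ab(s,t)}=\overset{m}{H}_{ab(s,t)}=0.$$ For $1\le a\le p$, $1\le s<t\le p$ and $1\le u<v\le p$, $$\overset{m}{H}_{(s,t)(u,v)a}=\begin{cases}\lambda_a^{-2}(\lambda_t-\lambda_a), & \text{if } s=u=a,\ t=v,\\ \lambda_a^{-2}(\lambda_s-\lambda_a), & \text{if } s=u,\ t=v=a,\\ 0, & \text{otherwise.}\end{cases}$$
   Context: $\mathcal S$ is the family of $p$-variate normal distributions $N_p(\bm 0,\bm\Sigma)$ with $\bm\Sigma=(\sigma_{ij})$ symmetric positive definite, viewed as a manifold with the Fisher information metric $\langle\cdot,\cdot\rangle$ of one observation. Identifying tangent vectors with symmetric matrices, $\langle\bm A,\bm B\rangle_{\bm\Sigma}=\frac12\mathrm{tr}(\bm\Sigma^{-1}\bm A\bm\Sigma^{-1}\bm B)$. The eigenvalues of $\bm\Sigma$ are assumed distinct, $\lambda_1>\dots>\lambda_p>0$, and $\bm\Sigma=\bm\Gamma\,\mathrm{diag}(\bm\lambda)\,\bm\Gamma^t$ with $\bm\Gamma$ orthogonal. ''The point $(\bm\lambda,\bm\Gamma)$'' means this $\bm\Sigma$. Spectral coordinates: for $\bm u=(u_{ij})_{1\le i<j\le p}$, let $\bm U(\bm u)$ be the skew-symmetric matrix with $(\bm U)_{ij}=u_{ij}$ for $i<j$. Near a point with eigenvector matrix $\bm\Gamma$, the coordinates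 $(\bm\lambda,\bm u)$ correspond to $\bm\Sigma(\bm\lambda,\bm u)=\bm\Gamma\exp(\bm U(\bm u))\,\mathrm{diag}(\bm\lambda)\,\exp(\bm U(\bm u))^t\bm\Gamma^t$. Put $\partial_a=\partial/\partial\lambda_a$ and $\partial_{(s,t)}=\partial/\partial u_{st}$ for $s<t$. Quantities at $(\bm\lambda,\bm\Gamma)$ are computed in the chart centred at $\bm\Gamma$ and evaluated at $\bm u=\bm 0$. $\mathcal M(\bm\Gamma)$ is the submanifold of $\mathcal S$ obtained by fixing $\bm\Gamma$ (coordinates $\bm\lambda$). $\mathcal A(\bm\lambda)$ is the submanifold obtained by fixing $\bm\lambda$ (local coordinates $\bm u$). Connections: write $\bm\Sigma^{-1}=(\sigma^{ij})$. The $e$-connection $\overset{e}{\nabla}$ is the flat torsion-free connection on $\mathcal S$ for which the natural parameters $\theta^{ii}=-\frac12\sigma^{ii}$ and $\theta^{ij}=-\sigma^{ij}$ ($i<j$) are affine coordinates. The $m$-connection $\overset{m}{\nabla}$ is the flat torsion-free connection on $\mathcal S$ for which the expectation parameters $(\sigma_{ij})_{i\le j}$ are affine coordinates. Embedding curvature components of $\mathcal M$ (with respect to $e$ and $m$) and of $\mathcal A$ (with respect to $m$): $$\overset{e}{H}_{ab(s,t)}=\langle\overset{e}{\nabla}_{\partial_a}\partial_b,\partial_{(s,t)}\rangle,\quad \overset{m}{H}_{ab(s,t)}=\langle\overset{m}{\nabla}_{\partial_a}\partial_b,\partial_{(s,t)}\rangle,\quad \overset{m}{H}_{(s,t)(u,v)a}=\langle\overset{m}{\nabla}_{\partial_{(s,t)}}\partial_{(u,v)},\partial_a\rangle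 .$$ *)

(* Defs.v *)
From mathcomp Require Export all_boot all_order all_algebra.
From mathcomp Require Export all_classical all_reals all_analysis.

Set Implicit Arguments.
Unset Strict Implicit.
Unset Printing Implicit Defensive.

Import Order.TTheory GRing.Theory Num.Theory numFieldNormedType.Exports.
Local Open Scope ring_scope.
Local Open Scope classical_set_scope.

(* Points of a chart with (finite) index type [I] are functions [I -> R]. *)
Definition partial (R : realType) (I : eqType) (V : normedModType R) (i : I)
    (f : (I -> R) -> V) (x : I -> R) : V :=
  derive1 (fun h : R => f (fun j => if j == i then x j + h else x j)) 0.

Definition expmx (R : realType) (p : nat) (U : 'M[R]_p) : 'M[R]_p :=
  limn (series (fun k => k`!%:R^-1 *: U ^+ k)).

(* The Fisher metric of N_p(0, S); tangent vectors are symmetric matrices. *)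
Definition fisher (R : realType) (p : nat) (S A B : 'M[R]_p) : R :=
  2^-1 * \tr (invmx S *m A *m invmx S *m B).

Definition strict_pair (p : nat) : Type :=
  {ij : 'I_p * 'I_p | (ij.1 < ij.2)%N}.
Definition weak_pair (p : nat) : Type :=
  {ij : 'I_p * 'I_p | (ij.1 <= ij.2)%N}.

Definition skew (R : realType) (p : nat) (u : strict_pair p -> R) : 'M[R]_p :=
  \sum_(k : strict_pair p)
     u k *: (delta_mx (val k).1 (val k).2 - delta_mx (val k).2 (val k).1).

(* [inl a] is the index of lambda_a and [inr (s, t)] that of u_st. *)
Definition spectral_index (p : nat) : Type := ('I_p + strict_pair p)%type.

Definition spectral_chart (R : realType) (p : nat) (G : 'M[R]_p)
    (x : spectral_index p -> R) : 'M[R]_p :=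
  let O := G *m expmx (skew (fun k => x (inr k))) in
  O *m diag_mx (\row_a x (inl a)) *m O^T.

(* The point (lambda, 0) of the chart. *)
Definition spectral_point (R : realType) (p : nat) (lam : 'I_p -> R)
    (c : spectral_index p) : R :=
  match c with inl a => lam a | inr _ => 0 end.

(* A global coordinate system on the manifold of covariance matrices:
   [coords_of] gives the coordinates of a matrix, [of_coords] the matrix having
   given coordinates. *)
Record coordinates (R : realType) (p : nat) := Coordinates {
  coords_of : 'M[R]_p -> weak_pair p -> R;
  of_coords : (weak_pair p -> R) -> 'M[R]_p }.

(* theta^ii = - sigma^ii / 2 and theta^ij = - sigma^ij for i < j, where
   (sigma^ij) = S^-1; conversely, the precision matrix with natural parameter
   theta is - \sum_(i <= j) theta^ij (E_ij + E_ji), the two elementary matrices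
   adding up to 2 E_ii on the diagonal. *)
Definition natural_coordinates (R : realType) (p : nat) : coordinates R p :=
  Coordinates
    (fun S k => let: (i, j) := val k in
       if i == j then - (2^-1 * invmx S i j) else - invmx S i j)
    (fun theta => invmx (- \sum_(k : weak_pair p)
       theta k *: (delta_mx (val k).1 (val k).2 + delta_mx (val k).2 (val k).1))).

Definition expectation_coordinates (R : realType) (p : nat) :
    coordinates R p :=
  Coordinates
    (fun S k => S (val k).1 (val k).2)
    (fun eta => \sum_(k : weak_pair p) eta k *:
       (let: (i, j) := val k in
        if i == j then delta_mx i i else delta_mx i j + delta_mx j i)).

(* The components of the tangent vector A at S: A acts on each coordinate
   function as a derivation. *)
Definition component (R : realType) (p : nat) (phi : coordinates R p)
    (S A : 'M[R]_p) (k : weak_pair p) : R :=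
  derive1 (fun h : R => coords_of phi (S + h *: A) k : R^o) 0.

Definition coord_vector (R : realType) (p : nat) (phi : coordinates R p)
    (S : 'M[R]_p) (k : weak_pair p) : 'M[R]_p :=
  partial k (of_coords phi) (coords_of phi S).

(* The flat torsion-free connection having [phi] as affine coordinates is the
   one for which the fields d/dphi^k are parallel, that is,
   nabla_X Y = \sum_k X(Y^k) d/dphi^k with Y^k the phi-components of Y.  Here
   X = d/dx_i is a coordinate field of a chart [Sig] with index type [I] and
   the vector field [Y] is given as a function of the coordinates x. *)
Definition flat_connection (R : realType) (p : nat) (phi : coordinates R p)
    (I : eqType) (Sig : (I -> R) -> 'M[R]_p) (i : I)
    (Y : (I -> R) -> 'M[R]_p) (x : I -> R) : 'M[R]_p :=
  \sum_(k : weak_pair p)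
     partial i (fun y => component phi (Sig y) (Y y) k : R^o) x
       *: coord_vector phi (Sig x) k.

(* < nabla_(d_i) d_j, d_k > at the point (lambda, Gamma), in the spectral chart
   centred at Gamma. *)
Definition embedding_curvature (R : realType) (p : nat)
    (phi : coordinates R p) (G : 'M[R]_p) (lam : 'I_p -> R)
    (i j k : spectral_index p) : R :=
  let Sig := spectral_chart G in
  let x0 := spectral_point lam in
  fisher (Sig x0)
    (flat_connection phi Sig i (partial j Sig) x0) (partial k Sig x0).

Definition He (R : realType) (p : nat) (G : 'M[R]_p) (lam : 'I_p -> R)
    (i j k : spectral_index p) : R :=
  embedding_curvature (natural_coordinates R p) G lam i j k.

Definition Hm (R : realType) (p : nat) (G : 'M[R]_p) (lam : 'I_p -> R)
    (i j k : spectral_index p) : R :=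
  embedding_curvature (expectation_coordinates R p) G lam i j k.

Definition lam_index (p : nat) (a : 'I_p) : spectral_index p := inl a.

Definition u_index (p : nat) (s t : 'I_p) (st : (s < t)%N) :
    spectral_index p :=
  inr (exist _ (s, t) st).

(* Main.v *)
From HB Require Import structures.
From mathcomp Require Import ring lra zify.
Require Import Defs.

(* Differentiating the exponential series termwise, the k-derivative at 0 of
   exp (h A + k B) is a power series in h with h-derivative (A B + B A) / 2 at
   0.  With D = diag(lambda) and E, F the skew matrices of u_st and u_uv, the
   second derivative of Sigma along u_st and u_uv is therefore G N G^T with
   N = T D + F D E^T + E D F^T + D T^T and T = (E F + F E) / 2.  It is the
   m-covariant derivative because the entries of Sigma are m-affine; its inner
   product with d/dlambda_a only sees the entry N_aa, which is computed
   directly.  For the e-connection, the entries of Sigma^-1 are affine, so that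
   nabla_X Y = Sigma X(Sigma^-1 Y Sigma^-1) Sigma (d(Sigma^-1) brings a minus
   sign twice).  Along d/dlambda_a the middle factor is diagonal in the frame G,
   whereas d Sigma / du_st has a zero diagonal in that frame; for the
   m-connection the derivative vanishes as Sigma is affine in lambda. *)

Set Implicit Arguments.
Unset Strict Implicit.
Unset Printing Implicit Defensive.

Import Order.TTheory GRing.Theory Num.Theory numFieldNormedType.Exports.
Local Open Scope ring_scope.
Local Open Scope classical_set_scope.

(** * Derivatives of matrix-valued functions and of series *)

Lemma is_derive_mxP (R : realFieldType) (V : normedModType R) (m n : nat)
    (M : V -> 'M[R]_(m, n)) (A : 'M[R]_(m, n)) (x v : V) :
  is_derive x v M A <->
  forall i j, is_derive x v (fun t => M t i j) (A i j).
Proof.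
split=> [[dM <-] i j|dM].
  split; first exact: ((derivable_mxP M x v).1 dM).
  by rewrite derive_mx// mxE.
have dM' : derivable M x v.
  by apply/derivable_mxP => i j; exact: (@ex_derive _ _ _ _ _ _ _ (dM i j)).
split=> //; rewrite derive_mx//; apply/matrixP => i j; rewrite mxE.
exact: (@derive_val _ _ _ _ _ _ _ (dM i j)).
Qed.

Lemma is_derive_mulmx (R : realFieldType) (V : normedModType R) (m n p : nat)
    (M : V -> 'M[R]_(m, n)) (N : V -> 'M[R]_(n, p)) dM dN (x v : V) :
  is_derive x v M dM -> is_derive x v N dN ->
  is_derive x v (fun t => M t *m N t) (dM *m N x + M x *m dN).
Proof.
move=> /is_derive_mxP dM' /is_derive_mxP dN'; apply/is_derive_mxP => i j.
rewrite (_ : (fun t => _) =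
    \sum_(k < n) ((fun t => M t i k) * (fun t => N t k j))); last first.
  by apply/funext => t; rewrite mxE fct_sumE.
apply: is_derive_eq; rewrite !mxE -big_split/=; apply: eq_bigr => k _.
by rewrite addrC /GRing.scale/=; congr (_ + _); rewrite mulrC.
Qed.

Lemma is_derive_trmx (R : realFieldType) (V : normedModType R) (m n : nat)
    (M : V -> 'M[R]_(m, n)) dM (x v : V) :
  is_derive x v M dM -> is_derive x v (fun t => (M t)^T) dM^T.
Proof.
move=> /is_derive_mxP dM'; apply/is_derive_mxP => i j; rewrite mxE.
rewrite (_ : (fun t => _) = (fun t => M t j i))//.
by apply/funext => t; rewrite mxE.
Qed.

Lemma is_derive1 (R : numFieldType) (V : normedModType R) (f : R -> V) (x : R)
    (df : V) :
  is_derive x 1 f df -> derive1 f x = df.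
Proof. by move=> [_ <-]; rewrite derive1E. Qed.

(** Since [b] is summable, the termwise remainders add up to at most a constant times [k ^+ 2].
    Hence the difference quotient of the sum at 0 differs from the sum of the [c' n] by a quantity
    of order [k]. *)
Lemma is_derive_series (R : realType) (V : completeNormedModType R)
    (c : nat -> R -> V) (c' : nat -> V) (b : nat -> R) :
  cvgn (series b) -> cvgn (series (c^~ 0)) -> cvgn (series c') ->
  (forall n k, `|k| <= 1 -> `|c n k - c n 0 - k *: c' n| <= k ^+ 2 * b n) ->
  is_derive (0 : R) (1 : R) (fun k => limn (series (c^~ k)))
    (limn (series c')).
Proof.
move=> cb c0 c1 bnd; set f := fun k => _; set l := limn _.
pose r k n := c n k - c n 0 - k *: c' n.
(* At [k = 1] the hypothesis bounds a norm by [b n] itself. *)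
have b0 n : 0 <= b n.
  have := bnd n 1; rewrite normr1 expr1n mul1r lexx => /(_ isT).
  by apply: le_trans.
have rem k : `|k| <= 1 -> `|f k - f 0 - k *: l| <= k ^+ 2 * limn (series b).
  move=> k1.
  have ckb : cvgn (series (k ^+ 2 *: b)) by exact: is_cvg_seriesZ.
  have crn : cvgn [normed series (r k)].
    apply: series_le_cvg ckb => [n|n|n]; [exact: normr_ge0| |exact: bnd].
    by apply: mulr_ge0; rewrite ?sqr_ge0.
  have cr := normed_cvg crn.
  have -> : f k = limn (series (r k)) + k *: l + f 0.
    apply: cvg_lim => //.
    have -> : c^~ k = r k + k *: c' + c^~ 0.
      apply/funext => n; rewrite [RHS](_ : _ = r k n + k *: c' n + c n 0)//.
      by rewrite /r !subrK.
    rewrite seriesD (seriesD (r k)) seriesZ; apply: cvgD; last exact: c0.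
    by apply: cvgD; [exact: cr|apply: cvgZl_tmp; exact: c1].
  rewrite !addrK -[_ * _](lim_seriesZ _ cb) (le_trans (lim_series_norm crn))//.
  by apply: lim_series_le; [exact: crn|exact: ckb|move=> n; exact: bnd].
have B0 : 0 <= limn (series b).
  by apply: limr_ge => //; near=> n; exact: sumr_ge0.
have cvgf : h^-1 *: (f (h *: 1 + 0) - f 0) @[h --> 0^'] --> l.
  apply/cvgrPdist_le => e e0; near=> h.
  have h0 : h != 0 by near: h; exact: nbhs_dnbhs_neq.
  have h1 : `|h| <= 1 by near: h; apply: dnbhs0_le.
  rewrite addr0 [h *: 1]mulr1 distrC.
  have -> : h^-1 *: (f h - f 0) - l = h^-1 *: (f h - f 0 - h *: l).
    by rewrite [RHS]scalerBr scalerK.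
  rewrite normrZ normfV ler_pdivrMl ?normr_gt0//.
  rewrite (le_trans (rem _ h1))// -real_normK ?num_real// expr2 -mulrA.
  rewrite ler_wpM2l//.
  (* Adding 1 keeps the denominator positive even when [b] sums to 0. *)
  have : `|h| <= e / (limn (series b) + 1).
    by near: h; apply: dnbhs0_le; rewrite divr_gt0// ltr_wpDl.
  rewrite ler_pdivlMr ?ltr_wpDl// => he; apply: le_trans he.
  by rewrite ler_wpM2l// lerDl.
split; first by apply/cvg_ex; exists l.
exact/cvg_lim.
Unshelve. all: by end_near. Qed.

(** * The matrix exponential *)

(** Completeness lets absolutely convergent series of matrices converge, which the exponential
    relies on. *)
HB.instance Definition _ (R : realType) (m n : nat) :=
  Uniform_isComplete.Build 'M[R]_(m, n) cauchy_cvg.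

Lemma normr_mxE (R : realFieldType) (m n : nat) (A : 'M[R]_(m, n)) i j :
  `|A i j| <= `|A|.
Proof.
rewrite [leRHS]/Num.Def.normr/= mx_normrE.
exact: (le_bigmax _ (fun ij : 'I_m * 'I_n => `|A ij.1 ij.2|) (i, j)).
Qed.

Lemma normr_mx_le (R : realFieldType) (m n : nat) (A : 'M[R]_(m, n)) (e : R) :
  0 <= e -> (forall i j, `|A i j| <= e) -> `|A| <= e.
Proof.
move=> e0 Ae; rewrite [leLHS]/Num.Def.normr/= mx_normrE.
by apply: bigmax_le => // -[].
Qed.

(** The norm is the largest absolute value of an entry, so it is submultiplicative only up to the
    inner dimension. For this reason the bounds below are imposed on [p] times the norm. *)
Lemma normr_mulmx (R : realFieldType) (m n p : nat) (A : 'M[R]_(m, n))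
    (B : 'M[R]_(n, p)) : `|A *m B| <= n%:R * `|A| * `|B|.
Proof.
apply: normr_mx_le => [|i j]; first by rewrite !mulr_ge0.
rewrite mxE (le_trans (ler_norm_sum _ _ _))//.
rewrite (@le_trans _ _ (\sum_(k < n) `|A| * `|B|))//.
  by apply: ler_sum => k _; rewrite normrM ler_pM// normr_mxE.
by rewrite sumr_const card_ord -mulrA mulr_natl.
Qed.

Lemma normr_mulmx_le (R : realFieldType) (p : nat) (A B : 'M[R]_p) (a b : R) :
  `|A| <= a -> p%:R * `|B| <= b -> `|A * B| <= a * b.
Proof.
move=> Aa Bb; rewrite (le_trans (normr_mulmx A B))// [_%:R * _]mulrC -mulrA.
by rewrite ler_pM// mulr_ge0.
Qed.

Lemma normr_expmx (R : realFieldType) (p : nat) (X : 'M[R]_p) (M : R)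
    (n : nat) :
  p%:R * `|X| <= M -> `|X ^+ n| <= M ^+ n.
Proof.
move=> XM; elim: n => [|n IHn]; last by rewrite !exprSr normr_mulmx_le.
rewrite !expr0; apply: normr_mx_le => // i j; rewrite mxE.
by case: (i == j); rewrite ?normr1 ?normr0.
Qed.

(* The derivative of X |-> X ^+ n in the direction B. *)
Fixpoint exp_diff (R : pzRingType) (X B : R) (n : nat) : R :=
  if n is m.+1 then exp_diff X B m * X + X ^+ m * B else 0.

(** Induction along the recursion: [(2 * M) ^+ n * M + M ^+ n * M] is at most [(2 * M) ^+ n.+1]. *)
Lemma exp_diff_bound (R : realFieldType) (p : nat) (X B : 'M[R]_p) (M : R) n :
  p%:R * `|X| <= M -> p%:R * `|B| <= M -> `|exp_diff X B n| <= (2 * M) ^+ n.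
Proof.
move=> XM BM; have M0 : 0 <= M by apply: le_trans XM; rewrite mulr_ge0.
elim: n => [|n IHn] /=; first by rewrite normr0.
rewrite exprSr (le_trans (ler_normD _ _))//.
have := normr_mulmx_le IHn XM; have := normr_mulmx_le (normr_expmx n XM) BM.
have : M ^+ n <= (2 * M) ^+ n by rewrite lerXn2r ?nnegrE ?mulr_ge0//; nra.
set a := `|_|; set b := `|_|; set c := M ^+ n; set d := _ ^+ n.
by move: a b c d => a b c d; nra.
Qed.

(** As [X + k *: B] obeys the bound [2 * M], the induction step costs
    [2 * M * (4 * M) ^+ n + M * (2 * M) ^+ n], which [(4 * M) ^+ n.+1] dominates. *)
Lemma exp_diff_remainder (R : realFieldType) (p : nat) (X B : 'M[R]_p)
    (M k : R) n :
  p%:R * `|X| <= M -> p%:R * `|B| <= M -> `|k| <= 1 ->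
  `|(X + k *: B) ^+ n - X ^+ n - k *: exp_diff X B n| <=
    k ^+ 2 * (4 * M) ^+ n.
Proof.
move=> XM BM k1; have M0 : 0 <= M by apply: le_trans XM; rewrite mulr_ge0.
have XBM : p%:R * `|X + k *: B| <= 2 * M.
  rewrite (@le_trans _ _ (p%:R * (`|X| + `|B|)))//; last by lra.
  rewrite ler_wpM2l// (le_trans (ler_normD _ _))// lerD2l normrZ.
  by rewrite ler_piMl.
elim: n => [|n IHn] /=.
  by rewrite !expr0 subrr scaler0 subr0 normr0 mulr1 sqr_ge0.
(* Multiplying the remainder of order [n] by [X + k *: B] misses the next one by a single term,
   quadratic in [k]. *)
have -> : (X + k *: B) ^+ n.+1 - X ^+ n.+1 -
    k *: (exp_diff X B n * X + X ^+ n * B) =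
    ((X + k *: B) ^+ n - X ^+ n - k *: exp_diff X B n) * (X + k *: B) +
    k ^+ 2 *: (exp_diff X B n * B).
  rewrite !exprSr -!mulmxE.
  move: ((X + k *: B) ^+ n) (X ^+ n) (exp_diff X B n) => P Q L.
  rewrite !mulmxBl !mulmxDr -!scalemxAl -!scalemxAr !scalerDr scalerA -expr2.
  apply/matrixP => i j; rewrite !mxE; ring.
rewrite (le_trans (ler_normD _ _))// normrZ [`|k ^+ 2|]ger0_norm ?sqr_ge0//.
have := normr_mulmx_le IHn XBM.
have := ler_wpM2l (sqr_ge0 k) (normr_mulmx_le (exp_diff_bound n XM BM) BM).
have : k ^+ 2 * (2 * M) ^+ n * M <= k ^+ 2 * (4 * M) ^+ n * M.
  rewrite ler_wpM2r// ler_wpM2l ?sqr_ge0//.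
  by rewrite lerXn2r ?nnegrE ?mulr_ge0//; nra.
have : 0 <= k ^+ 2 * (4 * M) ^+ n * M.
  by rewrite mulr_ge0// mulr_ge0 ?sqr_ge0// exprn_ge0// mulr_ge0.
rewrite [(4 * M) ^+ n.+1]exprSr.
set a := `|_ * (X + _)|; set b := k ^+ 2 * `|_|.
move: (k ^+ 2) a b ((2 * M) ^+ n) ((4 * M) ^+ n) => q a b c d; lra.
Qed.

Lemma is_cvg_series_exp_bound (R : realType) (p : nat) (u : nat -> 'M[R]_p)
    (C : R) :
  (forall n, `|u n| <= C ^+ n) -> cvgn (series (fun n => n`!%:R^-1 *: u n)).
Proof.
move=> uC; apply: normed_cvg.
apply: series_le_cvg (is_cvg_series_exp_coeff C) => [n|n|n].
- exact: normr_ge0.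
- by rewrite /exp_coeff/= divr_ge0// (le_trans _ (uC n)).
- by rewrite /exp_coeff/= normrZ normfV normr_nat mulrC ler_wpM2r.
Qed.

Lemma limn_series_single (R : realType) (V : normedModType R) (u : nat -> V) k :
  (forall n, n != k -> u n = 0) -> series u @ \oo --> u k.
Proof.
move=> u0; apply: cvg_near_cst; exists k.+1 => // n /= kn.
rewrite /series/= (bigD1_seq k) ?mem_index_iota ?iota_uniq//=.
by rewrite big1 ?addr0.
Qed.

(** The differential of the matrix exponential at [X] in the direction [B], as a termwise
    differentiated series; [X] and [B] need not commute. *)
Definition dexpmx (R : realType) (p : nat) (X B : 'M[R]_p) : 'M[R]_p :=
  limn (series (fun n => n`!%:R^-1 *: exp_diff X B n)).

Lemma is_derive_expmx (R : realType) (p : nat) (X B : 'M[R]_p) :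
  is_derive (0 : R) (1 : R) (fun k => expmx (X + k *: B)) (dexpmx X B).
Proof.
pose M := p%:R * (`|X| + `|B|).
have XM : p%:R * `|X| <= M by rewrite ler_wpM2l// lerDl.
have BM : p%:R * `|B| <= M by rewrite ler_wpM2l// lerDr.
pose c n k := n`!%:R^-1 *: (X + k *: B) ^+ n.
apply: (@is_derive_series _ _ c _ (exp_coeff (4 * M))).
- exact: is_cvg_series_exp_coeff.
- apply: (@is_cvg_series_exp_bound _ _ _ M) => n.
  by rewrite scale0r addr0 normr_expmx.
- apply: (@is_cvg_series_exp_bound _ _ _ (2 * M)) => n.
  exact: exp_diff_bound.
- move=> n k k1; rewrite /c scale0r addr0 scalerA [k * _]mulrC -scalerA.
  rewrite -!scalerBr normrZ normfV normr_nat mulrC /exp_coeff/= mulrA.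
  by rewrite ler_wpM2r// exp_diff_remainder.
Qed.

Lemma expmx0 (R : realType) (p : nat) : expmx (0 : 'M[R]_p) = 1%:M.
Proof.
apply: cvg_lim => //.
rewrite [X in _ --> X](_ : _ = 0`!%:R^-1 *: (0 : 'M[R]_p) ^+ 0).
  apply: limn_series_single => n n0.
  by rewrite expr0n (negbTE n0) scaler0.
by rewrite expr0 fact0 invr1 scale1r.
Qed.

(** The derivative of the power [n.+1] is homogeneous of degree [n] in the base point. This turns
    [dexpmx (h *: A) B] into a power series in [h]. *)
Lemma exp_diff_scale (R : realType) (p : nat) (A B : 'M[R]_p) (h : R) n :
  exp_diff (h *: A) B n.+1 = h ^+ n *: exp_diff A B n.+1.
Proof.
elim: n => [|n IHn]; first by rewrite /= expr0 scale1r !mul0r !expr0.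
have hA m : (h *: A) ^+ m = h ^+ m *: A ^+ m.
  elim: m => [|m IHm]; first by rewrite !expr0 scale1r.
  by rewrite !exprSr IHm -!mulmxE -scalemxAl -scalemxAr scalerA.
rewrite [LHS]/= -/(exp_diff _ _ n.+1) IHn hA -!mulmxE.
rewrite -!scalemxAl -scalemxAr scalerA -exprSr -scalerDr.
by [].
Qed.

Lemma dexpmx0 (R : realType) (p : nat) (B : 'M[R]_p) : dexpmx 0 B = B.
Proof.
apply: cvg_lim => //.
rewrite [X in _ --> X](_ : _ = 1`!%:R^-1 *: exp_diff 0 B 1).
  apply: limn_series_single => -[|[|n]]//= _; first by rewrite scaler0.
  by rewrite mulr0 exprS !mul0r addr0 scaler0.
by rewrite /= mul0r add0r expr0 mul1r invr1 scale1r.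
Qed.

Lemma is_derive_dexpmx (R : realType) (p : nat) (A B : 'M[R]_p) :
  is_derive (0 : R) (1 : R) (fun h => dexpmx (h *: A) B)
    (2^-1 *: (A * B + B * A)).
Proof.
pose M := p%:R * (`|A| + `|B|).
have AM : p%:R * `|A| <= M by rewrite ler_wpM2l// lerDl.
have BM : p%:R * `|B| <= M by rewrite ler_wpM2l// lerDr.
have coeff_ge0 n : 0 <= exp_coeff (2 * M) n.
  rewrite /exp_coeff/= divr_ge0// exprn_ge0// mulr_ge0//.
  by rewrite (le_trans _ AM)// mulr_ge0.
pose c n h := n`!%:R^-1 *: exp_diff (h *: A) B n.
(* Term [n] has degree [n - 1] in [h], so only [n = 2] is linear; its coefficient is
   [exp_diff A B 2] over [2!]. *)
pose c' n := if n == 2%N then 2^-1 *: (A * B + B * A) else 0.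
have c'l : series c' @ \oo --> 2^-1 *: (A * B + B * A).
  by apply: (@limn_series_single _ _ c' 2) => n /negbTE n2; rewrite /c' n2.
rewrite -(cvg_lim _ c'l)//.
apply: (@is_derive_series _ _ c _ (exp_coeff (2 * M))).
- exact: is_cvg_series_exp_coeff.
- apply: (@is_cvg_series_exp_bound _ _ _ (2 * M)) => n.
  apply: exp_diff_bound => //; rewrite scale0r normr0 mulr0.
  by apply: le_trans AM; rewrite mulr_ge0.
- by apply/cvg_ex; eexists; exact: c'l.
- case=> [|[|[|n]]] k k1.
  + by rewrite /c/= !scaler0 subrr subr0 normr0 mulr_ge0 ?sqr_ge0.
  + rewrite /c !exp_diff_scale !expr0 /c'/= scaler0 subrr subr0 normr0.
    by rewrite mulr_ge0 ?sqr_ge0.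
  + rewrite /c !exp_diff_scale !expr1 /c' scale0r scaler0 subr0/=.
    rewrite mul0r add0r expr0 expr1 mul1r !scalerA [k * _]mulrC.
    rewrite [B * A + _]addrC subrr normr0.
    by rewrite mulr_ge0 ?sqr_ge0.
  (* The remaining terms carry a power of [k] of degree at least 2, bounded by [k ^+ 2] because [k]
     has absolute value at most 1. *)
  + rewrite /c !exp_diff_scale /c' expr0n scale0r !scaler0 !subr0.
    rewrite 2!normrZ normfV normr_nat normrX mulrC -mulrA ler_pM//.
      rewrite -[k ^+ 2]ger0_norm ?sqr_ge0// normrX -addn2 exprD.
      by rewrite ler_piMl// exprn_ile1.
    by apply: ler_wpM2r => //; exact: exp_diff_bound.
Qed.

(** * The matrix inverse *)

(** Evaluation at [h] is a ring morphism, so it commutes with the determinant of a matrix of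
    polynomials. *)
Lemma horner_det (R : comNzRingType) (n : nat) (S A : 'M[R]_n) :
  exists P : {poly R}, forall h, \det (S + h *: A) = P.[h].
Proof.
exists (\det (map_mx polyC S + 'X *: map_mx polyC A)) => h.
rewrite -[RHS]/(horner_eval h _) -det_map_mx; congr (\det _).
apply/matrixP => i j; rewrite !mxE /= /horner_eval hornerD hornerM hornerX.
by rewrite !hornerC.
Qed.

Lemma horner_adj (R : comNzRingType) (n : nat) (S A : 'M[R]_n) i j :
  exists P : {poly R}, forall h, (\adj (S + h *: A)) i j = P.[h].
Proof.
have [P HP] := horner_det (row' j (col' i S)) (row' j (col' i A)).
exists (((-1) ^+ (j + i))%:P * P) => h; rewrite hornerM hornerC -HP mxE.
by congr (_ * \det _); apply/matrixP => k l; rewrite !mxE.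
Qed.

Lemma near_unitmx (R : realType) (n : nat) (S A : 'M[R]_n) :
  S \in unitmx -> \forall h \near (0 : R), S + h *: A \in unitmx.
Proof.
have [P HP] := horner_det S A; rewrite unitmxE unitfE => S0.
have P0 : P.[0] != 0 by rewrite -HP scale0r addr0.
near=> h; rewrite unitmxE unitfE HP; near: h.
apply: (@cvgr_neq0 _ _ _ _ _ (horner P) P.[0]) => //.
exact: continuous_horner.
Unshelve. all: by end_near. Qed.

Lemma is_derive_line (R : realType) (V : normedModType R) (S A : V) (x : R) :
  is_derive x (1 : R) (fun h : R => S + h *: A) A.
Proof.
have cvgf : h^-1 *: ((S + (h *: 1 + x) *: A) - (S + x *: A)) @[h --> 0^'] --> A.
  apply: (@cvg_trans _ ((cst A) @ 0^')); last exact: cvg_cst.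
  apply: near_eq_cvg; near=> h.
  have h0 : h != 0 by near: h; exact: nbhs_dnbhs_neq.
  by rewrite [h *: 1]mulr1 scalerDl opprD addrACA subrr add0r addrK scalerK.
split; first by apply/cvg_ex; exists A.
exact/cvg_lim.
Unshelve. all: by end_near. Qed.

Lemma is_derive_invmx (R : realType) (n : nat) (S A : 'M[R]_n) :
  S \in unitmx ->
  is_derive (0 : R) (1 : R) (fun h => invmx (S + h *: A))
    (- (invmx S *m A *m invmx S)).
Proof.
move=> S_unit; set f := fun h => _.
have S0 : f 0 = invmx S by rewrite /f scale0r addr0.
have df : derivable f (0 : R) 1.
  apply/derivable_mxP => i j.
  have [P HP] := horner_det S A; have [Q HQ] := horner_adj S A i j.
  (* By Cramer's rule each entry of the inverse is, near 0, a quotient of polynomials in [h]. *)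
  apply: (@near_eq_derivable _ _ _ (fun h => P.[h]^-1 * Q.[h])).
  - near=> h; have Su : S + h *: A \in unitmx by near: h; exact: near_unitmx.
    by rewrite /f /invmx Su mxE HP HQ.
  - apply: derivableM; last exact: derivable_horner.
    apply: derivableV; last exact: derivable_horner.
    by rewrite -HP scale0r addr0; move: S_unit; rewrite unitmxE unitfE.
split=> //.
(* Once derivability is known, differentiating the locally constant product of the matrix and its
   inverse determines the derivative. *)
have dM := is_derive_mulmx (is_derive_line S A 0) (derivableP df).
have d1 : is_derive (0 : R) (1 : R) (fun h => (S + h *: A) *m f h) 0.
  apply: (@near_eq_is_derive _ _ _ (cst 1%:M)).
  by near=> h; rewrite /f mulmxV//; near: h; exact: near_unitmx.
move: (@derive_val _ _ _ _ _ _ _ dM); rewrite (@derive_val _ _ _ _ _ _ _ d1).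
rewrite scale0r addr0 S0 => /esym/eqP; rewrite addrC addr_eq0 => /eqP e.
by rewrite -[LHS](mulKmx S_unit) e mulmxN mulmxA.
Unshelve. all: by end_near. Qed.

(** * Affine coordinates and their flat connections *)

Definition shift_coord (R : nmodType) (I : eqType) (x : I -> R) (i : I)
    (h : R) : I -> R := fun j => if j == i then x j + h else x j.

Lemma is_derive_partial (R : realType) (I : eqType) (V : normedModType R)
    (i : I) (f : (I -> R) -> V) (x : I -> R) (df : V) :
  is_derive (0 : R) (1 : R) (fun h => f (shift_coord x i h)) df ->
  partial i f x = df.
Proof. exact: is_derive1. Qed.

Lemma shift_coord0 (R : nmodType) (I : eqType) (x : I -> R) (i : I) :
  shift_coord x i 0 = x.
Proof. by apply/funext => j; rewrite /shift_coord addr0; case: ifP. Qed.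

Lemma sum_shift_coord (R : pzRingType) (I : finType) (V : lmodType R)
    (x : I -> R) (i : I) (h : R) (F : I -> V) :
  \sum_j shift_coord x i h j *: F j = \sum_j x j *: F j + h *: F i.
Proof.
rewrite (bigD1 i)//= [in RHS](bigD1 i)//= /shift_coord eqxx.
rewrite scalerDl addrAC; congr (_ + _ + _).
by apply: eq_bigr => j /negbTE ->.
Qed.

Definition sym_basis (R : pzRingType) (p : nat) (ij : 'I_p * 'I_p) : 'M[R]_p :=
  let: (i, j) := ij in
  if i == j then delta_mx i i else delta_mx i j + delta_mx j i.

Arguments sym_basis : simpl never.

Lemma sym_basis_sym (R : pzRingType) (p : nat) (ij : 'I_p * 'I_p) :
  (sym_basis R ij)^T = sym_basis R ij.
Proof.
case: ij => i j; rewrite /sym_basis; case: eqP => _.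
  by rewrite trmx_delta.
by rewrite linearD/= !trmx_delta addrC.
Qed.

Lemma sym_basisE (R : pzRingType) (p : nat) (ij : 'I_p * 'I_p) (r c : 'I_p) :
  (ij.1 <= ij.2)%N -> (r <= c)%N -> sym_basis R ij r c = (ij == (r, c))%:R.
Proof.
case: ij => i j /= ij rc; rewrite /sym_basis xpair_eqE.
case: (i =P j) => [<-|/eqP neq]; rewrite !mxE.
  by rewrite ![_ == i]eq_sym.
rewrite [r == i]eq_sym [c == j]eq_sym.
have [/andP[/eqP rj /eqP ci]|] := boolP ((r == j) && (c == i)).
  by case/negP: neq; rewrite -val_eqE eqn_leq ij -rj -ci.
by rewrite addr0.
Qed.

Lemma sum_sym_basis (R : pzRingType) (p : nat) (C : 'M[R]_p) :
  C^T = C ->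
  \sum_(k : weak_pair p) C (val k).1 (val k).2 *: sym_basis R (val k) = C.
Proof.
move=> CT.
have up (r c : 'I_p) : (r <= c)%N ->
    (\sum_(k : weak_pair p) C (val k).1 (val k).2 *: sym_basis R (val k)) r c =
    C r c.
  move=> rc; pose k0 : weak_pair p := exist _ (r, c) rc.
  rewrite summxE (bigD1 k0)//= mxE sym_basisE// eqxx mulr1.
  rewrite big1 ?addr0// => k kk0.
  rewrite mxE sym_basisE ?(valP k)//; rewrite -[(r, c)]/(val k0) val_eqE.
  by rewrite (negbTE kk0) mulr0.
apply/matrixP => r c; have [/up //|/ltnW cr] := leqP r c.
rewrite -{2}CT mxE -(up _ _ cr) !summxE; apply: eq_bigr => k _.
by rewrite !mxE; congr (_ * _); rewrite -[in LHS]sym_basis_sym mxE.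
Qed.

(** * The m-connection in expectation coordinates *)

Lemma component_expectation (R : realType) (p : nat) (S A : 'M[R]_p) k :
  component (expectation_coordinates R p) S A k = A (val k).1 (val k).2.
Proof.
apply: is_derive1.
exact: ((is_derive_mxP _ _ _ _).1 (is_derive_line S A 0)).
Qed.

Lemma coord_vector_expectation (R : realType) (p : nat) (S : 'M[R]_p) k :
  coord_vector (expectation_coordinates R p) S k = sym_basis R (val k).
Proof.
apply: is_derive_partial.
under eq_fun do rewrite /= sum_shift_coord.
exact: is_derive_line.
Qed.

(** The coordinate fields are constant and the components are the entries on and above the diagonal,
    so the connection is entrywise differentiation; symmetry recovers the rest of the matrix. *)
Lemma flat_connection_expectation (R : realType) (p : nat) (I : eqType)
    (Sig Y : (I -> R) -> 'M[R]_p) (i : I) (x : I -> R) (dY : 'M[R]_p) :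
  is_derive (0 : R) (1 : R) (fun h => Y (shift_coord x i h)) dY -> dY^T = dY ->
  flat_connection (expectation_coordinates R p) Sig i Y x = dY.
Proof.
move=> YdY dYT; rewrite -[RHS](sum_sym_basis dYT); apply: eq_bigr => k _.
rewrite coord_vector_expectation; congr (_ *: _); apply: is_derive_partial.
under eq_fun do rewrite component_expectation.
exact: ((is_derive_mxP _ _ _ _).1 YdY).
Qed.

(** * The e-connection in natural coordinates *)

(** Absorbs the factor one half in the diagonal parameters, so that both cases are handled by one
    formula. *)
Definition natural_weight (R : realType) (p : nat) (ij : 'I_p * 'I_p) : R :=
  if ij.1 == ij.2 then 2^-1 else 1.

Lemma scale_natural_weight (R : realType) (p : nat) (ij : 'I_p * 'I_p) :
  natural_weight R ij *: (delta_mx ij.1 ij.2 + delta_mx ij.2 ij.1) =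
  sym_basis R ij.
Proof.
case: ij => i j; rewrite /natural_weight /sym_basis/=; case: eqP => [->|_].
  by rewrite scalerDr -scalerDl (_ : 2^-1 + 2^-1 = 1) ?scale1r//; lra.
by rewrite scale1r.
Qed.

Lemma natural_coordinatesE (R : realType) (p : nat) (S : 'M[R]_p) k :
  coords_of (natural_coordinates R p) S k =
    - (natural_weight R (val k) * invmx S (val k).1 (val k).2).
Proof.
case: k => -[i j] ij; rewrite /natural_weight/=.
by case: eqP => // _; rewrite mul1r.
Qed.

Lemma component_natural (R : realType) (p : nat) (S A : 'M[R]_p) k :
  S \in unitmx ->
  component (natural_coordinates R p) S A k =
    natural_weight R (val k) * (invmx S *m A *m invmx S) (val k).1 (val k).2.
Proof.
move=> S_unit; apply: is_derive1.
under eq_fun do rewrite natural_coordinatesE.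
have dI := (is_derive_mxP _ _ _ _).1 (is_derive_invmx A S_unit)
  (val k).1 (val k).2.
have := is_deriveN (is_deriveZ (natural_weight R (val k)) dI).
by rewrite mxE scalerN opprK.
Qed.

Lemma coord_vector_natural (R : realType) (p : nat) (S : 'M[R]_p) k :
  S \in unitmx -> S^T = S ->
  coord_vector (natural_coordinates R p) S k =
    S *m (delta_mx (val k).1 (val k).2 + delta_mx (val k).2 (val k).1) *m S.
Proof.
move=> S_unit ST; apply: is_derive_partial.
under eq_fun do rewrite /= sum_shift_coord opprD -scalerN.
(* The precision matrix rebuilt from the natural coordinates of [S] is [invmx S]; this uses the
   symmetry of [S]. *)
rewrite (_ : - _ = invmx S); last first.
  rewrite -[RHS](sum_sym_basis (C := invmx S)) ?trmx_inv ?ST// -sumrN.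
  apply: eq_bigr => l _; rewrite -scale_natural_weight scalerA -scaleNr.
  congr (_ *: _); rewrite -[LHS]/(- coords_of (natural_coordinates R p) S l).
  by rewrite natural_coordinatesE opprK mulrC.
have := is_derive_invmx (- (delta_mx (val k).1 (val k).2 +
  delta_mx (val k).2 (val k).1)) (etrans (unitmx_inv S) S_unit).
by rewrite invmxK mulmxN mulNmx opprK.
Qed.

(** The natural components of [Y] are the weighted entries of [Y] multiplied by the inverse of [Sig]
    on both sides, and the coordinate fields undo this by multiplying by [Sig] on both sides. *)
Lemma flat_connection_natural (R : realType) (p : nat) (I : eqType)
    (Sig Y : (I -> R) -> 'M[R]_p) (i : I) (x : I -> R) (dF : 'M[R]_p) :
  (Sig x)^T = Sig x ->
  (\forall h \near (0 : R), Sig (shift_coord x i h) \in unitmx) ->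
  is_derive (0 : R) (1 : R) (fun h => invmx (Sig (shift_coord x i h)) *m
    Y (shift_coord x i h) *m invmx (Sig (shift_coord x i h))) dF ->
  dF^T = dF ->
  flat_connection (natural_coordinates R p) Sig i Y x = Sig x *m dF *m Sig x.
Proof.
move=> ST Su FdF dFT.
have Sxu : Sig x \in unitmx by have := nbhs_singleton Su; rewrite shift_coord0.
rewrite -[in RHS](sum_sym_basis dFT) mulmx_sumr mulmx_suml.
apply: eq_bigr => k _; rewrite coord_vector_natural// -scale_natural_weight.
rewrite -!scalemxAr -!scalemxAl scalerA; congr (_ *: _).
apply: is_derive_partial.
have dFk := (is_derive_mxP _ _ _ _).1 FdF (val k).1 (val k).2.
have dwF := is_deriveZ (natural_weight R (val k)) dFk.
(* The formula for the components needs an invertible matrix, which is available only for [h] near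
   0. *)
rewrite mulrC; apply: near_eq_is_derive dwF; near=> h.
by rewrite component_natural//; near: h.
Unshelve. all: by end_near. Qed.

(** * The spectral chart *)

Definition skew_basis (R : pzRingType) (p : nat) (st : strict_pair p) : 'M[R]_p :=
  delta_mx (val st).1 (val st).2 - delta_mx (val st).2 (val st).1.

Lemma skew_shift (R : realType) (p : nat) (x : spectral_index p -> R) st h :
  skew (fun k => shift_coord x (inr st) h (inr k)) =
  skew (fun k => x (inr k)) + h *: skew_basis R st.
Proof. exact: (sum_shift_coord (fun k => x (inr k)) st h (@skew_basis R p)). Qed.

Lemma skew0 (R : realType) (p : nat) : skew (fun _ : strict_pair p => 0 : R) = 0.
Proof. by rewrite /skew big1// => k _; rewrite scale0r. Qed.

Lemma diag_shift (R : realType) (p : nat) (x : spectral_index p -> R) b h :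
  diag_mx (\row_a shift_coord x (inl b) h (inl a)) =
  diag_mx (\row_a x (inl a)) + h *: delta_mx b b.
Proof.
have sE i : shift_coord x (inl b) h (inl i) = x (inl i) + h * (i == b)%:R.
  rewrite /shift_coord (_ : (inl i == inl b) = (i == b))//.
  by case: (i == b); rewrite ?mulr1 ?mulr0 ?addr0.
apply/matrixP => i j; rewrite !mxE sE mulrnDl; congr (_ + _).
rewrite -mulrnAr; congr (_ * _); case: (i =P j) => [<-|ij].
  by rewrite andbb.
rewrite mulr0n; case: (i =P b) => // ib; case: (j =P b) => // jb.
by case: ij; rewrite ib.
Qed.

Section spectral_chart_derivatives.
Variables (R : realType) (p : nat) (G : 'M[R]_p) (x : spectral_index p -> R).
Let U : 'M[R]_p := skew (fun k => x (inr k)).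
Let D : 'M[R]_p := diag_mx (\row_a x (inl a)).

Lemma spectral_chart_shift_lam a h :
  spectral_chart G (shift_coord x (inl a) h) =
  spectral_chart G x +
    h *: (G *m expmx U *m delta_mx a a *m (G *m expmx U)^T).
Proof.
rewrite /spectral_chart diag_shift mulmxDr mulmxDl.
by rewrite -scalemxAr -scalemxAl.
Qed.

Lemma partial_lam_spectral_chart a :
  partial (inl a) (spectral_chart G) x =
  G *m expmx U *m delta_mx a a *m (G *m expmx U)^T.
Proof.
apply: is_derive_partial; under eq_fun do rewrite spectral_chart_shift_lam.
exact: is_derive_line.
Qed.

(** Kept at an arbitrary point of the chart, because the second derivative differentiates this
    expression once more. *)
Lemma partial_u_spectral_chart st :
  partial (inr st) (spectral_chart G) x =
  G *m dexpmx U (skew_basis R st) *m D *m (G *m expmx U)^T +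
  G *m expmx U *m D *m (G *m dexpmx U (skew_basis R st))^T.
Proof.
apply: is_derive_partial; rewrite /spectral_chart.
under eq_fun do rewrite skew_shift.
have dO := is_derive_mulmx (is_derive_cst G (0 : R) (1 : R))
  (is_derive_expmx U (skew_basis R st)).
have := is_derive_mulmx (is_derive_mulmx dO (is_derive_cst D (0 : R) (1 : R)))
  (is_derive_trmx dO).
by rewrite /cst !mul0mx !add0r mulmx0 addr0 scale0r addr0.
Qed.

End spectral_chart_derivatives.

(** * Embedding curvatures in the frame of eigenvectors *)

Lemma invmx_eq (R : comUnitRingType) (n : nat) (A B : 'M[R]_n) :
  A *m B = 1%:M -> invmx A = B.
Proof.
by move=> AB; rewrite -[LHS]mulmx1 -AB mulKmx//; case: (mulmx1_unit AB).
Qed.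

Lemma fisher_sandwich (R : realType) (p : nat) (S F B : 'M[R]_p) :
  S \in unitmx -> fisher S (S *m F *m S) B = 2^-1 * \tr (F *m B).
Proof. by move=> Su; rewrite /fisher -(mulmxA S) mulKmx// mulmxK. Qed.

Lemma mxtrace_diag_mul (R : pzRingType) (n : nat) (d : 'rV[R]_n) (M : 'M[R]_n) :
  \tr (diag_mx d *m M) = \sum_i d 0 i * M i i.
Proof. by rewrite /mxtrace mul_diag_mx; apply: eq_bigr => i _; rewrite mxE. Qed.

Lemma delta_mx_diag (R : pzRingType) (n : nat) (a : 'I_n) :
  delta_mx a a = diag_mx (delta_mx 0 a) :> 'M[R]_n.
Proof.
apply/matrixP => i j; rewrite !mxE eqxx/= [j == a]eq_sym.
case: (i =P j) => [->|ij]; first by rewrite [a == j]eq_sym andbb.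
case: (i =P a) => // ia; case: (a =P j) => // aj.
by case: ij; rewrite ia.
Qed.

Lemma skew_basis_diag (R : pzRingType) (p : nat) (st : strict_pair p) i :
  skew_basis R st i i = 0.
Proof. by rewrite !mxE andbC subrr. Qed.

Lemma skew_basisT (R : pzRingType) (p : nat) (st : strict_pair p) :
  (skew_basis R st)^T = - skew_basis R st.
Proof. by rewrite /skew_basis linearB/= !trmx_delta opprB. Qed.

(** The mixed second derivative at 0 of [X *m D *m X^T] for [X = expmx (h *: A + k *: B)]; [T] is
    that of [X] itself. *)
Definition second_variation (R : realType) (p : nat) (A B D : 'M[R]_p) :
    'M[R]_p :=
  let T := 2^-1 *: (A *m B + B *m A) in
  T *m D + B *m D *m A^T + A *m D *m B^T + D *m T^T.

Lemma second_variationT (R : realType) (p : nat) (A B D : 'M[R]_p) :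
  D^T = D -> (second_variation A B D)^T = second_variation A B D.
Proof.
move=> DT; rewrite /second_variation; move: (2^-1 *: _) => T.
rewrite !linearD/= !trmx_mul !trmxK DT !mulmxA.
by rewrite addrC [X in _ + X = _]addrC [X in _ + (_ + X) = _]addrC !addrA.
Qed.

(** Skewness makes the diagonal entry of [T] equal to minus the sum of the [A a k * B a k]. Each
    outer term contributes it times [d 0 a], and each cross term contributes the sum weighted by
    [d 0 k]. *)
Lemma second_variation_diag (R : realType) (p : nat) (A B : 'M[R]_p)
    (d : 'rV[R]_p) a :
  A^T = - A -> B^T = - B ->
  second_variation A B (diag_mx d) a a =
  2 * \sum_k A a k * (B a k * (d 0 k - d 0 a)).
Proof.
move=> AT BT; rewrite /second_variation AT BT; set T := 2^-1 *: _.
have Ta : T a a = - \sum_k A a k * B a k.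
  rewrite mxE [X in _ * X]mxE.
  have prod (X Y : 'M[R]_p) :
      Y^T = - Y -> (X *m Y) a a = - \sum_k X a k * Y a k.
    move=> YT; rewrite mxE -sumrN; apply: eq_bigr => k _.
    by rewrite -mulrN; congr (_ * _); have /matrixP/(_ a k) := YT; rewrite !mxE.
  rewrite !prod// (eq_bigr (fun k => A a k * B a k) (fun k _ => mulrC _ _)).
  by lra.
have TD : (T *m diag_mx d) a a = T a a * d 0 a by rewrite mul_mx_diag mxE.
have DT : (diag_mx d *m T^T) a a = T a a * d 0 a.
  by rewrite mul_diag_mx !mxE mulrC.
have XDY (X Y : 'M[R]_p) : Y^T = - Y ->
    (X *m diag_mx d *m (- Y)) a a = \sum_k X a k * Y a k * d 0 k.
  move=> YT; rewrite -YT mul_mx_diag mxE; apply: eq_bigr => k _.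
  by rewrite !mxE mulrAC.
have addE (X Y : 'M[R]_p) : (X + Y) a a = X a a + Y a a by rewrite mxE.
rewrite !addE TD DT !XDY// Ta.
have -> : \sum_k B a k * A a k * d 0 k = \sum_k A a k * B a k * d 0 k.
  by apply: eq_bigr => k _; rewrite [B a k * _]mulrC.
have -> : \sum_k A a k * (B a k * (d 0 k - d 0 a)) =
    \sum_k (A a k * B a k * d 0 k - A a k * B a k * d 0 a).
  by apply: eq_bigr => k _; rewrite mulrA mulrBr.
rewrite sumrB -mulr_suml; lra.
Qed.

Section orthogonal_frame.
Variables (R : realType) (p : nat) (G : 'M[R]_p).
Hypothesis G_orth : G *m G^T = 1%:M.

(** The matrix that reads [A] in the frame of eigenvectors. Orthogonality of [G] makes this
    compatible with products, inverses and traces, so computations reduce to the diagonal case. *)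
Definition frame_conj (A : 'M[R]_p) : 'M[R]_p := G *m A *m G^T.

Lemma frame_conjM A B : frame_conj A *m frame_conj B = frame_conj (A *m B).
Proof.
by rewrite /frame_conj !mulmxA -[_ *m G^T *m G]mulmxA (mulmx1C G_orth) mulmx1.
Qed.

Lemma frame_conjD A B : frame_conj A + frame_conj B = frame_conj (A + B).
Proof. by rewrite /frame_conj mulmxDr mulmxDl. Qed.

Lemma frame_conjN A : - frame_conj A = frame_conj (- A).
Proof. by rewrite /frame_conj mulmxN mulNmx. Qed.

Lemma frame_conjT A : (frame_conj A)^T = frame_conj A^T.
Proof. by rewrite /frame_conj !trmx_mul trmxK mulmxA. Qed.

Lemma frame_conj1 : frame_conj 1%:M = 1%:M.
Proof. by rewrite /frame_conj mulmx1. Qed.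

Lemma mxtrace_frame_conj A : \tr (frame_conj A) = \tr A.
Proof. by rewrite /frame_conj mxtrace_mulC mulmxA (mulmx1C G_orth) mul1mx. Qed.

Variable lam : 'I_p -> R.
Hypothesis lam_pos : forall a, 0 < lam a.
Let D : 'M[R]_p := diag_mx (\row_a lam a).
Let D' : 'M[R]_p := diag_mx (\row_a (lam a)^-1).
Let Sig := spectral_chart G.
Let x0 := spectral_point lam.

Lemma diag_lamV : D *m D' = 1%:M.
Proof.
rewrite mulmx_diag; apply/matrixP => i j; rewrite !mxE mulfV//.
by rewrite gt_eqF.
Qed.

Lemma spectral_chart_point : Sig x0 = frame_conj D.
Proof. by rewrite /Sig /spectral_chart skew0 expmx0 mulmx1. Qed.

Lemma frame_conjV : invmx (frame_conj D) = frame_conj D'.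
Proof. by apply: invmx_eq; rewrite frame_conjM diag_lamV frame_conj1. Qed.

Lemma frame_conj_unit : frame_conj D \in unitmx.
Proof.
have : frame_conj D *m frame_conj D' = 1%:M.
  by rewrite frame_conjM diag_lamV frame_conj1.
by case/mulmx1_unit.
Qed.

(** Moving an eigenvalue keeps all [u] coordinates at 0, so this field is constant along the
    curve. *)
Lemma partial_lam_point a h b :
  partial (inl b) Sig (shift_coord x0 (inl a) h) = frame_conj (delta_mx b b).
Proof. by rewrite partial_lam_spectral_chart skew0 expmx0 mulmx1. Qed.

Lemma partial_lam_point0 b : partial (inl b) Sig x0 = frame_conj (delta_mx b b).
Proof. by rewrite partial_lam_spectral_chart skew0 expmx0 mulmx1. Qed.

Lemma partial_u_point st :
  partial (inr st) Sig x0 =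
  frame_conj (skew_basis R st *m D + D *m (skew_basis R st)^T).
Proof.
rewrite partial_u_spectral_chart skew0 expmx0 dexpmx0 mulmx1 -frame_conjD.
by rewrite /frame_conj trmx_mul !mulmxA.
Qed.

Lemma He_lam_lam_u a b st : He G lam (inl a) (inl b) (inr st) = 0.
Proof.
rewrite /He /embedding_curvature -/Sig -/x0 partial_u_point.
pose A := frame_conj (delta_mx a a); pose W := frame_conj (delta_mx b b).
have Sh h : Sig (shift_coord x0 (inl a) h) = frame_conj D + h *: A.
  rewrite /Sig spectral_chart_shift_lam skew0 expmx0 mulmx1.
  by rewrite -[spectral_chart G x0]/(Sig x0) spectral_chart_point.
have dI := is_derive_invmx A frame_conj_unit.
have dF := is_derive_mulmx
  (is_derive_mulmx dI (is_derive_cst W (0 : R) (1 : R))) dI.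
rewrite mulmx0 addr0 /cst scale0r addr0 in dF.
set F' := (X in is_derive _ _ _ X) in dF.
(* Only the diagonal shape of the derivative matters; its entries are left to unification and then
   forgotten. *)
have [d F'd] : exists d, F' = frame_conj (diag_mx d).
  rewrite /F' /A /W frame_conjV !delta_mx_diag.
  eexists; rewrite !(frame_conjM, frame_conjN, mulNmx, mulmxN, mulmx_diag).
  rewrite frame_conjD -opprD -[diag_mx _ + _]linearD -linearN.
  reflexivity.
clearbody F'.
have -> : flat_connection (natural_coordinates R p) Sig (inl a)
    (partial (inl b) Sig) x0 = frame_conj D *m F' *m frame_conj D.
  rewrite -spectral_chart_point.
  apply: (@flat_connection_natural _ _ _ Sig (partial (inl b) Sig) (inl a) x0 F').
  - by rewrite spectral_chart_point frame_conjT tr_diag_mx.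
  - near=> h; rewrite Sh; near: h; exact: near_unitmx frame_conj_unit.
  - under eq_fun do rewrite Sh partial_lam_point. exact: dF.
  - by rewrite F'd frame_conjT tr_diag_mx.
rewrite spectral_chart_point fisher_sandwich ?frame_conj_unit//.
rewrite F'd frame_conjM mxtrace_frame_conj mxtrace_diag_mul.
(* Only diagonal entries of the [u] derivative enter the trace, and they vanish since [skew_basis]
   has zero diagonal. *)
rewrite big1 ?mulr0// => i _.
rewrite mxE mul_mx_diag mul_diag_mx skew_basisT.
rewrite [X in X + _]mxE [X in _ + X]mxE [X in _ + _ * X]mxE !skew_basis_diag.
by rewrite mul0r oppr0 mulr0 addr0 mulr0.
Unshelve. all: by end_near. Qed.

Lemma Hm_lam_lam_u a b st : Hm G lam (inl a) (inl b) (inr st) = 0.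
Proof.
rewrite /Hm /embedding_curvature -/Sig -/x0.
rewrite (_ : flat_connection _ _ _ _ _ = 0).
  by rewrite /fisher mulmx0 !mul0mx mxtrace0 mulr0.
apply: flat_connection_expectation; last exact: trmx0.
under eq_fun do rewrite partial_lam_point.
exact: is_derive_cst.
Qed.

(** Along [u_st] the exponent is [h *: E1], so the product rule needs only the derivatives at 0 of
    the exponential and of its differential. *)
Lemma second_partial_u_point st uv :
  is_derive (0 : R) (1 : R)
    (fun h => partial (inr uv) Sig (shift_coord x0 (inr st) h))
    (frame_conj (second_variation (skew_basis R st) (skew_basis R uv) D)).
Proof.
set E1 := skew_basis R st; set E2 := skew_basis R uv.
have shiftu h : skew (fun k => shift_coord x0 (inr st) h (inr k)) = h *: E1.
  by rewrite skew_shift skew0 add0r.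
under eq_fun do rewrite partial_u_spectral_chart shiftu.
have cG := is_derive_cst G (0 : R) (1 : R).
have cD := is_derive_cst D (0 : R) (1 : R).
have := is_derive_expmx 0 E1; under eq_fun do rewrite add0r.
rewrite dexpmx0 => dexp.
have dO := is_derive_mulmx cG dexp.
have dL := is_derive_mulmx cG (is_derive_dexpmx E1 E2).
have := is_deriveD (is_derive_mulmx (is_derive_mulmx dL cD) (is_derive_trmx dO))
  (is_derive_mulmx (is_derive_mulmx dO cD) (is_derive_trmx dL)).
rewrite /cst !mul0mx !add0r !mulmx0 !addr0 !scale0r dexpmx0 expmx0 mulmx1.
rewrite -!mulmxE /second_variation -!frame_conjD /frame_conj.
rewrite !trmx_mul !mulmxA !addrA.
exact.
Qed.

(** Pairing with the diagonal unit matrix at [a] extracts one diagonal entry, scaled by the inverse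
    square of [lam a]; the 2 in that entry cancels the one half of the metric. *)
Lemma Hm_u_u_lam st uv a :
  Hm G lam (inr st) (inr uv) (inl a) =
  lam a ^- 2 *
  \sum_k skew_basis R st a k * (skew_basis R uv a k * (lam k - lam a)).
Proof.
rewrite /Hm /embedding_curvature -/Sig -/x0 partial_lam_point0.
rewrite (flat_connection_expectation Sig (second_partial_u_point st uv));
  last first.
  by rewrite frame_conjT second_variationT// tr_diag_mx.
rewrite spectral_chart_point /fisher frame_conjV !frame_conjM mxtrace_frame_conj.
rewrite delta_mx_diag mxtrace_mulC mxtrace_diag_mul (bigD1 a)//=.
rewrite big1 ?addr0; last first.
  by move=> i /negbTE ia; rewrite mxE ia andbF mul0r.
rewrite mxE !eqxx mul1r mul_mx_diag mxE mul_diag_mx mxE.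
have rowE (f : 'I_p -> R) r i : (\row_j f j) r i = f i by rewrite mxE.
rewrite second_variation_diag ?skew_basisT// !rowE -exprVn.
have -> : \sum_k skew_basis R st a k *
    (skew_basis R uv a k * ((\row_b lam b) 0 k - lam a)) =
    \sum_k skew_basis R st a k * (skew_basis R uv a k * (lam k - lam a)).
  by apply: eq_bigr => k _; rewrite rowE.
by move: (lam a)^-1 (\sum_k _) => l s; field.
Qed.

End orthogonal_frame.

(** * Evaluation of the sum and the case distinction *)

Lemma sum_skew_basis (R : realType) (p : nat) (s t : 'I_p) (st : (s < t)%N) a
    (f : 'I_p -> R) :
  \sum_k skew_basis R (exist _ (s, t) st) a k * f k =
  (a == s)%:R * f t - (a == t)%:R * f s.
Proof.
under eq_bigr do rewrite !mxE/= mulrBl.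
rewrite sumrB (bigD1 t)//= [X in _ - X](bigD1 s)//= !big1 ?addr0 ?eqxx ?andbT//.
  by move=> k /negbTE ks; rewrite ks andbF mul0r.
by move=> k /negbTE ks; rewrite ks andbF mul0r.
Qed.

Theorem proposition2 (R : realType) (p : nat) (lam : 'I_p -> R) (G : 'M[R]_p)
    (lam_pos : forall a : 'I_p, 0 < lam a)
    (lam_decr : forall a b : 'I_p, (a < b)%N -> lam b < lam a)
    (G_orth : G *m G^T = 1%:M) :
  (forall (a b s t : 'I_p) (st : (s < t)%N),
     He G lam (lam_index a) (lam_index b) (u_index st) = 0 /\
     Hm G lam (lam_index a) (lam_index b) (u_index st) = 0) /\
  (forall (a s t u v : 'I_p) (st : (s < t)%N) (uv : (u < v)%N),
     Hm G lam (u_index st) (u_index uv) (lam_index a) =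
       if [&& s == u, u == a & t == v] then (lam a) ^- 2 * (lam t - lam a)
       else if [&& s == u, t == v & v == a] then (lam a) ^- 2 * (lam s - lam a)
       else 0).
Proof.
split=> [a b s t st|a s t u v st uv].
  by split; [exact: He_lam_lam_u | exact: Hm_lam_lam_u].
rewrite (Hm_u_u_lam G_orth lam_pos) sum_skew_basis !mxE/=.
have neq (i j : 'I_p) : (i < j)%N -> i == j = false.
  by move=> ij; apply/negbTE; rewrite -val_eqE ltn_eqF.
have [sa|sa] := eqVneq a s.
  subst s; rewrite (neq _ _ st) mul0r subr0 mul1r.
  (* The opposite matching of the two pairs would give both [a < t] and [t < a]. *)
  have -> : (a == v) && (t == u) = false.
    apply/negbTE/negP => /andP[/eqP av /eqP tu].
    by move: st uv; rewrite tu av; lia.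
  rewrite subr0 [u == a]eq_sym andbA andbb.
  case: (a == u) => /=; last by rewrite mul0r mulr0.
  have [tv|] := eqVneq t v; last by rewrite mul0r mulr0.
  by rewrite mul1r.
rewrite mul0r sub0r.
have -> : [&& s == u, u == a & t == v] = false.
  apply/negbTE/negP => /and3P[/eqP su /eqP ua _].
  by move: sa; rewrite su ua eqxx.
have [ta|ta] := eqVneq a t; last first.
  rewrite mul0r oppr0 mulr0.
  case: and3P => // -[_ /eqP tv /eqP va]; by move: ta; rewrite tv va eqxx.
subst t; rewrite mul1r.
have -> : (a == u) && (s == v) = false.
  apply/negbTE/negP => /andP[/eqP au /eqP sv].
  by move: st uv; rewrite au sv; lia.
(* For [a = t] both skew matrices contribute a minus sign, and the two cancel. *)
rewrite [v == a]eq_sym andbb sub0r mulNr opprK andbC.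
by case: (_ && _); rewrite ?mul1r ?mul0r ?mulr0.
Qed.
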